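(* Let $G$ be any connected graph (finite or infinite). Then $G$ has a nested set of bonds that efficiently distinguishes all the edge-blocks of $G$; that is, there is a set $N$ of bonds of $G$, any two of which are nested, such that for any two disjoint edge-blocks $\beta_1,\beta_2$ of $G$ some bond in $N$ distinguishes $\beta_1$ and $\beta_2$ efficiently.
   Context: Ends of $G$ are vertex-ends: equivalence classes of rays of $G$, two rays being equivalent if no finite set of vertices separates them. $\Omega(G)$ is the set of ends and $\hat V(G):=V(G)\cup\Omega(G)$. A set $X\subseteq \hat V(G)$ lives in a vertex set $C\subseteq V(G)$ (or in a subgraph $C$) if all vertices of $X$ lie in $C$ and every ray of every end in $X$ has a tail in $G[C]$ (resp. in $C$). An edge set $F\subseteq E(G)$ separates two elements of $\hat V(G)$ if they live in distinct components of $G-F$. For $k\in\mathbb N\cup\{\infty\}$, two elements of $\hat V(G)$ are $(<k)$-inseparable if they cannot be separated by fewer than $k$ edges; this is an equivalence relation on $\hat V(G)$, whose classes are the $k$-edge-blocks of $G$. An edge-block is a set that is a $k$-edge-block for some $k\in\mathbb N\cup\{\infty\}$. An edge set $F$ distinguishes two edge-blocks if they live in distinct components of $G-F$, and distinguishes them efficiently if moreover no edge set of smaller size distinguishes them. A cut of $G$ is a set $E(A,B)$ of all edges between the parts of a bipartition $\{A,B\}$ of $V(G)$ into nonempty sets (its sides); a bond is a cut whose sides both induce connected subgraphs. Two cuts $F_1,F_2$ are nested if $F_1$ has a side $V_1$ and $F_2$ has a side $V_2$ with $V_1\subseteq V_2$. *)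

(* Defs.v *)
From mathcomp Require Export all_boot.
From mathcomp Require Export boolp classical_sets functions cardinality.
Set Implicit Arguments.
Unset Strict Implicit.
Unset Printing Implicit Defensive.
Local Open Scope classical_set_scope.
Local Open Scope card_scope.

(* A simple graph, finite or infinite: a vertex set inside a carrier [T] and a
   set of 2-element subsets of it.  The carrier is fixed so that subgraphs of a
   graph are again graphs on the same carrier. *)
Record graph (T : Type) := Graph {
  vertices : set T;
  edges : set (set T);
  edges_pair : forall e, edges e -> exists x y,
    [/\ vertices x, vertices y, x <> y & e = [set x; y]]
}.

Section Graph.
Variable T : Type.
Implicit Types (G H C D : graph T) (F : set (set T)) (S U A B : set T).

Definition subgraph H G := vertices H `<=` vertices G /\ edges H `<=` edges G.

Definition adj G : rel T := fun x y => `[< edges G [set x; y] >].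

(* Walks are used in place of paths; two vertices are linked by one iff they
   are linked by the other. *)
Definition linked G (x y : T) := exists p : seq T, path (adj G) x p /\ last x p = y.

Definition connected G :=
  vertices G !=set0 /\
  forall x y, vertices G x -> vertices G y -> linked G x y.

Definition component G C :=
  [/\ subgraph C G, connected C &
      forall D, subgraph D G -> connected D -> subgraph C D -> D = C].

Lemma del_edges_pair G F e : (edges G `\` F) e -> exists x y,
  [/\ vertices G x, vertices G y, x <> y & e = [set x; y]].
Proof. by case=> /edges_pair. Qed.

(* G - F, for a set F of edges *)
Definition del_edges G F := Graph (@del_edges_pair G F).

Lemma induced_pair G U e : [set e | edges G e /\ e `<=` U] e -> exists x y,
  [/\ (vertices G `&` U) x, (vertices G `&` U) y, x <> y & e = [set x; y]].
Proof.
case=> /edges_pair[x [y [Gx Gy xy ->]]] eU; exists x, y.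
by split=> //; split=> //; apply: eU; [left|right].
Qed.

(* G[U] *)
Definition induced G U := Graph (@induced_pair G U).

(* G - S, for a set S of vertices *)
Definition del_vertices G S := induced G (~` S).

(* A ray is given by its vertices in order, starting at its first vertex. *)
Definition ray G (r : nat -> T) :=
  injective r /\ forall n, edges G [set r n; r n.+1].

Definition has_tail_in (r : nat -> T) C :=
  exists m, ray C (fun n => r (m + n)).

Definition separates_rays G S (r r' : nat -> T) := exists C D,
  [/\ component (del_vertices G S) C, component (del_vertices G S) D, C <> D,
      has_tail_in r C & has_tail_in r' D].

Definition ray_equiv G (r r' : nat -> T) :=
  ~ exists S, [/\ S `<=` vertices G, finite_set S & separates_rays G S r r'].

Definition is_end G (w : set (nat -> T)) :=
  exists2 r, ray G r & w = [set r' | ray G r' /\ ray_equiv G r r'].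

(* Vertices are tagged by [inl] and ends by [inr]. *)
Definition point : Type := T + set (nat -> T).

Implicit Types (p q : point) (X : set point).

(* \hat V(G) *)
Definition Vhat G : set point := [set p | match p with
  | inl x => vertices G x
  | inr w => is_end G w
  end].

Definition lives_in X C :=
  (forall x, X (inl x) -> vertices C x) /\
  (forall w r, X (inr w) -> w r -> has_tail_in r C).

Definition live_in_distinct_components G F X Y := exists C D,
  [/\ component (del_edges G F) C, component (del_edges G F) D, C <> D,
      lives_in X C & lives_in Y D].

Definition separates G F p q := live_in_distinct_components G F [set p] [set q].

(* |F| < k for k in N u {oo}, where [None] stands for oo. *)
Definition fewer_than F (k : option nat) :=
  match k with
  | Some n => exists m, (m < n)%N /\ F #= `I_m
  | None => finite_set F
  end.

Definition inseparable G (k : option nat) p q :=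
  ~ exists F, [/\ F `<=` edges G, fewer_than F k & separates G F p q].

Definition k_edge_block G (k : option nat) X :=
  exists2 p, Vhat G p & X = [set q | Vhat G q /\ inseparable G k p q].

Definition edge_block G X := exists k, k_edge_block G k X.

Definition distinguishes G F X Y :=
  F `<=` edges G /\ live_in_distinct_components G F X Y.

Definition smaller F1 F2 := F1 #<= F2 /\ ~ (F2 #<= F1).

Definition distinguishes_efficiently G F X Y :=
  distinguishes G F X Y /\
  ~ exists F', smaller F' F /\ distinguishes G F' X Y.

Definition bipartition G A B :=
  [/\ A !=set0, B !=set0, A `|` B = vertices G & A `&` B = set0].

(* E(A,B) *)
Definition edges_between G A B : set (set T) :=
  [set e | edges G e /\ exists a b, [/\ A a, B b & e = [set a; b]]].

(* F is a cut of G and A is one of its sides. *)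
Definition cut_side G F A :=
  exists2 B, bipartition G A B & F = edges_between G A B.

Definition bond G F := exists A B,
  [/\ bipartition G A B, F = edges_between G A B,
      connected (induced G A) & connected (induced G B)].

Definition nested G F1 F2 := exists V1 V2,
  [/\ cut_side G F1 V1, cut_side G F2 V2 & V1 `<=` V2].

End Graph.

(* Main.v *)
(* The vertices and ends inside a vertex set X with finite cut(X) behave like an
   ultrafilter: every point lies in exactly one of X and its complement, and
   membership commutes with intersections.  Besides this, ends matter only through
   the fact that a point inside X lives in one component of G[X], and edge-blocks
   enter only through one representative each: a minimum cut between the
   representatives is a bond distinguishing the two blocks efficiently.

   Through a given edge there are only finitely many bonds of a given finite size,
   hence a finite cut is crossed by finitely many bonds of each size.  The nested
   set is built size by size.  For each pair of points separated by a minimum cut of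
   size n, submodularity lets one uncross such a cut from the smaller bonds already
   chosen; among the resulting cuts one takes those crossed by the fewest bonds of
   size n.  Two cuts chosen at the same stage cannot cross: two opposite corners
   would again be minimum cuts, while the crossing numbers of opposite corners add up
   to strictly less than those of the two cuts. *)
Require Import Defs.
From mathcomp Require Import finmap.
Set Implicit Arguments.
Unset Strict Implicit.
Unset Printing Implicit Defensive.
Local Open Scope classical_set_scope.
Local Open Scope card_scope.

(** * Finite cardinals *)

Section FiniteCard.
Variable U : choiceType.
Implicit Types A B C D : set U.

(** On an infinite set [fset_set] is empty and [fcard] is 0, so comparisons of sizes carry
    finiteness along. *)
Definition fcard A := #|` fset_set A|%fset.

Lemma fcard_sub A B : finite_set B -> A `<=` B -> fcard A <= fcard B.
Proof.
move=> fB sAB; have fA := sub_finite_set sAB fB.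
by apply: fsubset_leq_card; move: sAB; rewrite (fset_set_sub fA fB).
Qed.

Lemma fcard_sub_eq A B :
  finite_set B -> A `<=` B -> fcard B <= fcard A -> A = B.
Proof.
move=> fB sAB leBA; have fA := sub_finite_set sAB fB.
apply: fset_set_inj => //; apply/eqP.
by rewrite eqEfcard leBA andbT; move: sAB; rewrite (fset_set_sub fA fB).
Qed.

Lemma fcard_proper A B x :
  finite_set B -> A `<=` B -> B x -> ~ A x -> fcard A < fcard B.
Proof.
move=> fB sAB Bx nAx; rewrite ltnNge; apply/negP => leBA.
by apply: nAx; rewrite (fcard_sub_eq fB sAB leBA).
Qed.

Lemma fcardUI A B : finite_set A -> finite_set B ->
  fcard (A `|` B) + fcard (A `&` B) = fcard A + fcard B.
Proof. by move=> fA fB; rewrite /fcard fset_setU// fset_setI// cardfsUI. Qed.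

(** Inclusion-exclusion. With C, D arising from opposite corners of A, B this gives submodularity of
    cuts; the strict form below serves for counting crossing bonds. *)
Lemma fcard_exchange A B C D : finite_set A -> finite_set B ->
  C `|` D `<=` A `|` B -> C `&` D `<=` A `&` B ->
  fcard C + fcard D <= fcard A + fcard B.
Proof.
move=> fA fB sU sI.
have fU : finite_set (A `|` B) by rewrite finite_setU.
have [fC fD] : finite_set C /\ finite_set D.
  by move: (sub_finite_set sU fU); rewrite finite_setU.
rewrite -fcardUI// -(fcardUI fA fB) leq_add//; apply: fcard_sub => //.
exact: finite_setIl.
Qed.

Lemma fcard_exchange_lt A B C D x : finite_set A -> finite_set B ->
  C `|` D `<=` A `|` B -> C `&` D `<=` A `&` B ->
  A x -> ~ C x -> ~ D x ->
  fcard C + fcard D < fcard A + fcard B.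
Proof.
move=> fA fB sU sI Ax nCx nDx.
have fU : finite_set (A `|` B) by rewrite finite_setU.
have [fC fD] : finite_set C /\ finite_set D.
  by move: (sub_finite_set sU fU); rewrite finite_setU.
rewrite -fcardUI// -(fcardUI fA fB) -addSn leq_add//.
  by apply: (@fcard_proper _ _ x) => //; [left|case].
by apply: fcard_sub => //; apply: finite_setIl.
Qed.

Lemma fcardP A n : A #= `I_n <-> finite_set A /\ fcard A = n.
Proof.
split=> [An|[/finite_setP[m Am] <-]]; last by rewrite /fcard (card_fset_set Am).
by split; [apply/finite_setP; exists n|exact: card_fset_set].
Qed.

End FiniteCard.

Lemma finite_avoid (U : Type) (A : set U) (f : nat -> U) :
  finite_set A -> injective f -> exists m, forall n, ~ A (f (m + n)).
Proof.
move=> fA injf.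
have /finite_fsetP[S fS] : finite_set (f @^-1` A).
  by apply: finite_preimage => // x y _ _; apply: injf.
have leS x : x \in S -> x <= \max_(i <- S) i.
  by move=> xS; rewrite (big_rem _ xS) /= leq_maxl.
exists (\max_(i <- S) i).+1 => n Afn.
have /leS : (\max_(i <- S) i).+1 + n \in S.
  by have : (f @^-1` A) ((\max_(i <- S) i).+1 + n) by []; rewrite fS.
by rewrite leqNgt ltn_addr.
Qed.

(** * Walks, components and cuts *)

Section Walks.
Variable T : Type.
Implicit Types (G H C D : graph T) (X Y W : set T) (x y : T).

Lemma set2_inj (a b c d : T) :
  [set a; b] = [set c; d] -> (a = c /\ b = d) \/ (a = d /\ b = c).
Proof.
move=> E.
have : [set c; d] a by rewrite -E; left.
have : [set c; d] b by rewrite -E; right.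
have : [set a; b] c by rewrite E; left.
have : [set a; b] d by rewrite E; right.
by move=> /= [] ? [] ? [] ? [] ?; subst; tauto.
Qed.

Lemma graph_eq G H : vertices G = vertices H -> edges G = edges H -> G = H.
Proof.
case: G H => [V E p] [V' E' p'] /= EV EE; subst V' E'.
by congr Graph; apply: Prop_irrelevance.
Qed.

Lemma edges_vertices G a b :
  edges G [set a; b] -> vertices G a /\ vertices G b.
Proof.
by move=> /edges_pair[x [y [Gx Gy _ /set2_inj[] [-> ->]]]].
Qed.

Lemma linked_ind G x (P : T -> Prop) : P x ->
  (forall a b, P a -> edges G [set a; b] -> P b) ->
  forall y, linked G x y -> P y.
Proof.
move=> Px Pstep y [p [+ <-]].
elim: p x Px => [//|z p IH] x Px /= /andP[/asboolP xz zp].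
exact: IH (Pstep _ _ Px xz) zp.
Qed.

Lemma linked_refl G x : linked G x x.
Proof. by exists [::]. Qed.

Lemma linked_trans G y x z : linked G x y -> linked G y z -> linked G x z.
Proof.
move=> [p [xp <-]] [q [yq <-]]; exists (p ++ q).
by rewrite cat_path xp yq last_cat.
Qed.

Lemma linked_edge G x y : edges G [set x; y] -> linked G x y.
Proof. by move=> xy; exists [:: y]; split=> //=; rewrite andbT; apply/asboolP. Qed.

Lemma linked_sym G x y : linked G x y -> linked G y x.
Proof.
apply: (linked_ind (P := fun y => linked G y x)) => [|a b xa ab].
  exact: linked_refl.
by apply: linked_trans xa; apply: linked_edge; rewrite setUC.
Qed.

Lemma linked_sub G H x y : edges G `<=` edges H -> linked G x y -> linked H x y.
Proof.
move=> GH; apply: linked_ind => [|a b xa ab]; first exact: linked_refl.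
by apply: linked_trans xa _; apply/linked_edge/GH.
Qed.

Lemma connected_root G x : vertices G x ->
  (forall y, vertices G y -> linked G x y) -> connected G.
Proof.
move=> Gx Gl; split; first by exists x.
by move=> y z /Gl xy /Gl; apply: linked_trans; apply: linked_sym.
Qed.

Definition comp G x := induced G [set y | linked G x y].

Lemma linked_comp G x y : linked G x y -> linked (comp G x) x y.
Proof.
move=> xy; suff [] : linked G x y /\ linked (comp G x) x y by [].
elim/linked_ind: y / xy => [|a b [xa xa'] ab]; first by split; exact: linked_refl.
have xb : linked G x b by apply: linked_trans xa (linked_edge ab).
split=> //; apply: linked_trans xa' _; apply: linked_edge; split=> //.
by move=> _ [] ->.
Qed.

Lemma comp_component G x : vertices G x -> component G (comp G x).
Proof.
move=> Gx; split.
- by split=> [y|e] [].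
- apply: (@connected_root _ x); first by split=> //; exact: linked_refl.
  by move=> y [_ xy]; exact: linked_comp.
- move=> D [DG DG'] [_ Dl] [CD CD'].
  have Dx : vertices D x by apply: CD; split=> //; exact: linked_refl.
  have DC y : vertices D y -> linked G x y.
    by move=> Dy; apply: linked_sub (Dl _ _ Dx Dy).
  apply: graph_eq; apply/seteqP; split=> //.
    by move=> y Dy; split; [exact: DG|exact: DC].
  move=> e De; split; first exact: DG'.
  by have [a [b [Da Db _ ->]]] := edges_pair De; move=> _ [] ->; exact: DC.
Qed.

Lemma component_comp G C x : component G C -> vertices C x -> C = comp G x.
Proof.
move=> [[CG CG'] [_ Cl] Cmax] Cx; symmetry.
have CC y : vertices C y -> linked G x y.
  by move=> Cy; apply: linked_sub (Cl _ _ Cx Cy).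
have [subC connC _] := comp_component (CG _ Cx).
apply: Cmax => //; split=> [y Cy|e Ce]; first by split; [exact: CG|exact: CC].
split; first exact: CG'.
by have [a [b [Ca Cb _ ->]]] := edges_pair Ce; move=> _ [] ->; exact: CC.
Qed.

End Walks.

(** * Cuts of vertex sets and nestedness of their sides *)

Section Cuts.
Variables (T : Type) (G : graph T).
Implicit Types (X Y W Z : set T) (x y : T).

(** X may contain points outside [vertices G]; only its trace on the vertices matters, so the other
    side can be taken to be the full complement. *)
Definition cut X : set (set T) :=
  [set e | edges G e /\ exists a b, [/\ X a, ~ X b & e = [set a; b]]].

Lemma cut_edge X a b : edges G [set a; b] -> cut X [set a; b] <-> (X a <-> ~ X b).
Proof.
move=> Gab; split.
  by move=> [_ [c [d [Xc Xd E]]]]; case: (set2_inj E) => [] [-> ->]; tauto.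
move=> Xab; split=> //; case: (EM (X a)) => Xa.
  by exists a, b; split=> //; tauto.
by exists b, a; split; rewrite 1?setUC//; case: (EM (X b)) => //; tauto.
Qed.

Lemma cutC X : cut (~` X) = cut X.
Proof.
apply/seteqP; split=> e [Ge [a [b [Xa Xb E]]]]; split=> //; exists b, a.
  by rewrite setUC; split=> //; apply: contrapT.
by rewrite setUC; split=> //= /(_ Xa).
Qed.

Lemma cutI_sub X Y : cut (X `&` Y) `|` cut (X `|` Y) `<=` cut X `|` cut Y.
Proof.
move=> e [] [Ge [a [b [Xa Xb E]]]]; rewrite {e}E in Ge *.
all: have := (cut_edge X Ge, cut_edge Y Ge); move: Xa Xb => /=.
all: move=> + + [-> ->].
all: by move: (EM (X a)) (EM (X b)) (EM (Y a)) (EM (Y b)); tauto.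
Qed.

Lemma cutU_sub X Y : cut (X `&` Y) `&` cut (X `|` Y) `<=` cut X `&` cut Y.
Proof.
move=> e [[Ge [a [b [Xa Xb E]]]]]; rewrite {e}E in Ge *.
have := (cut_edge X Ge, cut_edge Y Ge, cut_edge (X `|` Y) Ge).
move: Xa Xb => /= + + [[-> ->] ->].
by move: (EM (X a)) (EM (X b)) (EM (Y a)) (EM (Y b)); tauto.
Qed.

Lemma cut_submod X Y : finite_set (cut X) -> finite_set (cut Y) ->
  fcard (cut (X `&` Y)) + fcard (cut (X `|` Y)) <= fcard (cut X) + fcard (cut Y).
Proof.
move=> fX fY; apply: fcard_exchange => //; [exact: cutI_sub|exact: cutU_sub].
Qed.

Lemma finite_cutI X Y : finite_set (cut X) -> finite_set (cut Y) ->
  finite_set (cut (X `&` Y)).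
Proof.
move=> fX fY; apply: (@sub_finite_set _ _ (cut X `|` cut Y)).
  by move=> e ?; apply: cutI_sub; left.
by rewrite finite_setU.
Qed.

(* One of the four corners of X and Y contains no vertex of G. *)
Definition nest X Y := [\/ forall x, vertices G x -> X x -> Y x,
  forall x, vertices G x -> X x -> ~ Y x,
  forall x, vertices G x -> ~ X x -> Y x |
  forall x, vertices G x -> ~ X x -> ~ Y x].

Lemma nestS X Y : nest X Y -> nest Y X.
Proof.
case=> XY; [apply: Or44|apply: Or42|apply: Or43|apply: Or41] => x Gx.
- by move=> nY /XY-/(_ Gx).
- by move=> Yx /XY-/(_ Gx).
- by move=> nY; apply: contrapT => /XY-/(_ Gx).
- by move=> Yx; apply: contrapT => /XY-/(_ Gx).
Qed.

Lemma nest_congr X Y Z : (forall x, vertices G x -> Y x <-> Z x) ->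
  nest X Y -> nest X Z.
Proof.
by move=> YZ [] XY; [apply: Or41|apply: Or42|apply: Or43|apply: Or44] => x Gx;
  rewrite -(YZ x Gx); apply: XY.
Qed.

Lemma nestCr X Y : nest X Y -> nest X (~` Y).
Proof.
by case=> XY; [apply: Or42|apply: Or41|apply: Or44|apply: Or43] => x Gx Xx;
  rewrite /setC /= ?notK; have := XY x Gx Xx.
Qed.

Lemma nestCl X Y : nest X Y -> nest (~` X) Y.
Proof. by move=> /nestS/nestCr/nestS. Qed.

Lemma nestCrE X Y : nest X (~` Y) <-> nest X Y.
Proof. by split=> /nestCr //; rewrite setCK. Qed.

Lemma nestClE X Y : nest (~` X) Y <-> nest X Y.
Proof. by split=> /nestCl //; rewrite setCK. Qed.

Lemma nestI_r X Y : nest (X `&` Y) Y. Proof. by apply: Or41 => x _ []. Qed.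

(** A side of W that misses X or Y misses the corner, and one that lies in both lies in the corner.
    In the remaining case one side of W lies in X and the other in Y, so X and Y cover all vertices,
    against their crossing. *)
Lemma nest_corner W X Y : nest W X -> nest W Y -> ~ nest X Y ->
  nest W (X `&` Y).
Proof.
move=> [] WX [] WY nXY.
all: first
 [ apply: Or42 => x Gx Wx [Xx Yx]; by [apply: (WX x)|apply: (WY x)]
 | apply: Or44 => x Gx Wx [Xx Yx]; by [apply: (WX x)|apply: (WY x)]
 | apply: Or41 => x Gx Wx; split; by [apply: (WX x)|apply: (WY x)]
 | apply: Or43 => x Gx Wx; split; by [apply: (WX x)|apply: (WY x)]
 | case: nXY; apply: Or43 => x Gx nX; case: (EM (W x)) => Wx;
   by [apply: (WY x)|case: nX; apply: (WX x)] ].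
Qed.

Lemma nest_cornerU W X Y : nest W X -> nest W Y -> ~ nest X Y ->
  nest W (X `|` Y).
Proof.
move=> WX WY nXY; rewrite -(setCK (X `|` Y)) setCU; apply: nestCr.
by apply: nest_corner; rewrite ?nestCrE ?nestClE ?nestCrE.
Qed.

(** Whether X and Y agree at a vertex does not change along an edge, hence is constant on a
    connected graph. *)
Lemma cut_inj X Y : connected G -> cut X = cut Y ->
  (forall x, vertices G x -> X x <-> Y x) \/
  (forall x, vertices G x -> X x <-> ~ Y x).
Proof.
move=> [[v Gv] Gl] EXY.
have step a b : edges G [set a; b] -> (X a <-> ~ X b) <-> (Y a <-> ~ Y b).
  by move=> Gab; rewrite -!cut_edge// EXY.
case: (EM (X v <-> Y v)) => XYv; [left|right] => x Gx.
  apply: (linked_ind (P := fun x => X x <-> Y x)) (Gl _ _ Gv Gx) => //.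
  move=> a b + /step; move: (EM (X a)) (EM (X b)) (EM (Y a)) (EM (Y b)); tauto.
apply: (linked_ind (P := fun x => X x <-> ~ Y x)) (Gl _ _ Gv Gx).
  by move: XYv (EM (X v)) (EM (Y v)); tauto.
by move=> a b + /step; move: (EM (X a)) (EM (X b)) (EM (Y a)) (EM (Y b)); tauto.
Qed.

Lemma nest_cut X Y Z : connected G -> cut Y = cut Z -> nest X Y -> nest X Z.
Proof.
move=> Gc /(cut_inj Gc)[] YZ; first exact: nest_congr.
move=> /nestCr; apply: nest_congr => x /YZ.
by rewrite /setC /=; move: (EM (Z x)); tauto.
Qed.

End Cuts.

(** * Finiteness of the set of bonds crossing a cut *)

Section FinitelyManyBonds.
Variable T : Type.
Implicit Types (G H : graph T) (X Y W Z : set T) (x y : T) (e : set T).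

Definition bond_side G X :=
  connected (induced G X) /\ connected (induced G (~` X)).

Lemma bond_sideC G X : bond_side G X -> bond_side G (~` X).
Proof. by case=> cX cnX; split; rewrite ?setCK. Qed.

Definition bonds_through G e n : set (set (set T)) := [set F | exists X,
  [/\ bond_side G X, F = cut G X, F e, finite_set F & fcard F = n]].

(** E is the edge set of one walk from x to y. It is chosen before X, and the finiteness arguments
    rest on this uniformity. *)
Lemma walk_meets_cut G x y : linked G x y -> exists E, finite_set E /\
  forall X, ~ (X x <-> X y) -> exists2 e, E e & cut G X e.
Proof.
apply: (linked_ind (P := fun y => exists E, finite_set E /\
  forall X, ~ (X x <-> X y) -> exists2 e, E e & cut G X e)).
  by exists set0; split=> [|X []].
move=> a b [E [fE Exa]] Gab; exists (E `|` [set [set a; b]]); split.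
  by rewrite finite_setU; split=> //; exact: finite_set1.
move=> X Xxb; case: (EM (X x <-> X a)) => [Xxa|/Exa[e Ee Xe]].
  exists [set a; b]; first by right.
  by apply/cut_edge => //; move: (EM (X a)) (EM (X b)); tauto.
by exists e => //; left.
Qed.

Lemma connected_induced_del G X e d : e d -> ~ X d ->
  connected (induced G X) -> connected (induced (del_edges G [set e]) X).
Proof.
move=> ed nXd [X0 Xl]; split=> // x y Xx Xy.
apply: linked_sub (Xl _ _ Xx Xy) => f [Gf fX]; split=> //; split=> //= fe.
by apply/nXd/fX; rewrite fe.
Qed.

Lemma bond_side_del G X e : cut G X e -> bond_side G X ->
  bond_side (del_edges G [set e]) X.
Proof.
move=> [_ [a [b [Xa Xb E]]]] [cX cnX].
split; [apply: connected_induced_del cX|apply: connected_induced_del cnX].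
- by rewrite E; right.
- exact: Xb.
- by rewrite E; left.
- exact.
Qed.

Lemma cut_del G X e : cut (del_edges G [set e]) X = cut G X `\ e.
Proof. by apply/seteqP; split=> f [[Gf fe] Xf]. Qed.

(* Induction on n: either e is a bridge, or every bond through e meets a fixed walk of
   G - e joining the ends of e, and becomes a smaller bond of G - e. *)
Lemma finite_bonds_through G e n : finite_set (bonds_through G e n).
Proof.
elim: n G e => [|n IH] G e.
  apply: (@sub_finite_set _ _ set0) => // F [X [_ _ Fe fF /eqP]].
  rewrite /fcard cardfs_eq0 => /eqP/fset_set_set0-/(_ fF) F0.
  by rewrite F0 in Fe.
case: (EM (edges G e)) => [Ge|nGe]; last first.
  by apply: (@sub_finite_set _ _ set0) => // F [X [_ -> []]].
have [x [y [_ _ _ exy]]] := edges_pair Ge.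
pose G' := del_edges G [set e].
case: (EM (linked G' x y)) => [/walk_meets_cut[E [fE Exy]]|nxy]; last first.
  apply: (@sub_finite_set _ _ [set [set e]]); last exact: finite_set1.
  move=> F [X [[[_ Xl] [_ nXl]] -> [_ [c [d [Xc Xd ecd]]]] _ _]].
  apply/seteqP; split=> [f [Gf [a [b [Xa Xb fab]]]]|_ ->]; last first.
    by split=> //; exists c, d.
  (* A second edge f = ab of the bond, together with walks inside the two connected sides, would
     bypass e. *)
  apply: contrapT => /= fe; apply: nxy.
  have [Gc Gd] : vertices G c /\ vertices G d.
    by apply: edges_vertices; rewrite -ecd.
  have [Ga Gb] : vertices G a /\ vertices G b.
    by apply: edges_vertices; rewrite -fab.
  have ca : linked G' c a.
    apply: linked_sub (Xl c a _ _) => // h [Gh hX]; split=> //= he.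
    by apply/Xd/hX; rewrite he ecd; right.
  have bd : linked G' b d.
    apply: linked_sub (nXl b d _ _) => // h [Gh hX]; split=> //= he.
    by apply: (hX c) => //; rewrite he ecd; left.
  have ab : linked G' a b by apply: linked_edge; rewrite -fab.
  have cd := linked_trans (linked_trans ca ab) bd.
  rewrite exy in ecd; case: (set2_inj ecd) => [] [-> ->] //.
  exact: linked_sym.
apply: (@sub_finite_set _ _
    (\bigcup_(e' in E) ((fun F => F `|` [set e]) @` bonds_through G' e' n))).
  move=> _ [X [bX -> Fe fF nF]].
  have [|e' Ee' Xe'] := Exy X.
    rewrite exy in Ge Fe; have := (cut_edge X Ge).1 Fe.
    by move: (EM (X x)) (EM (X y)); tauto.
  exists e' => //; exists (cut G X `\ e).
    exists X; rewrite -cut_del -/G'; split=> //.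
    - exact: bond_side_del.
    - by rewrite cut_del; exact: finite_setD.
    - rewrite cut_del; apply/eqP; rewrite -eqSS -nF /fcard.
      rewrite (cardfsD1 e (fset_set (cut G X))) fset_setD1//.
      by rewrite in_fset_set// mem_set.
  apply/seteqP; split=> f /=; first by case=> [[]|->].
  by case: (EM (f = e)) => [->|]; [right|left].
apply: bigcup_finite => // e' _; apply: finite_image; exact: IH.
Qed.

(** These are the endvertices of the cut edges, not ends of the graph. *)
Definition ends_of_cut G X : set T := \bigcup_(e in cut G X) e.

Lemma finite_ends_of_cut G X :
  finite_set (cut G X) -> finite_set (ends_of_cut G X).
Proof.
move=> fX; apply: bigcup_finite => // _ [_ [a [b [_ _ ->]]]].
exact: finite_set2.
Qed.

(** A walk in G[Y] could change sides of X only along a cut edge, whose ends are not in Y; so Y lies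
    on one side of X. *)
Lemma connected_nest G X Y : connected (induced G Y) ->
  (forall s, ends_of_cut G X s -> ~ Y s) -> nest G X Y.
Proof.
move=> [[u [Gu Yu]] Yl] sY; apply: nestS.
have key x : vertices G x -> Y x -> X x <-> X u.
  move=> Gx Yx.
  have : linked (induced G Y) u x by apply: Yl.
  apply: (linked_ind (P := fun x => X x <-> X u)) => // a b Xa [Gab abY].
  apply: contrapT => Xab; apply: (sY a); last by apply: abY; left.
  exists [set a; b]; last by left.
  by apply/cut_edge => //; move: Xa Xab (EM (X a)) (EM (X b)); tauto.
case: (EM (X u)) => Xu; [apply: Or41|apply: Or42] => x Gx Yx.
  exact/(key x).
by move=> /(key x Gx Yx).
Qed.

Definition crossing_bonds G X n : set (set (set T)) := [set F | exists W,
  [/\ bond_side G W, F = cut G W, finite_set F, fcard F = n & ~ nest G X W]].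

(* A bond avoiding the walks from a root v to all ends of edges of the cut of X has a
   side containing none of those ends; this side is connected, so X does not split
   it. *)
Lemma finite_crossing_bonds G X n : connected G ->
  finite_set (cut G X) -> finite_set (crossing_bonds G X n).
Proof.
move=> [[v Gv] Gl] fX.
have /choice[E EP] s : exists E, finite_set E /\ (vertices G s ->
    forall W, ~ (W v <-> W s) -> exists2 e, E e & cut G W e).
  case: (EM (vertices G s)) => [Gs|]; last by exists set0.
  by have [E [fE EP]] := walk_meets_cut (Gl _ _ Gv Gs); exists E.
apply: (@sub_finite_set _ _ (\bigcup_(s in ends_of_cut G X)
    \bigcup_(e in E s) bonds_through G e n)); last first.
  apply: bigcup_finite; first exact: finite_ends_of_cut.
  move=> s _; apply: bigcup_finite; first by case: (EP s).
  by move=> e _; exact: finite_bonds_through.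
move=> F [W [bW FX fF nF nXW]]; apply: contrapT => noE; apply: nXW.
have Ws s : ends_of_cut G X s -> W v <-> W s.
  move=> Xs; apply: contrapT => Wvs.
  have Gs : vertices G s.
    case: Xs => e [Gab [a [b [_ _ eab]]]] es; rewrite eab in Gab es.
    by have [Ga Gb] := edges_vertices Gab; case: es => ->.
  have [e Ee We] := (EP s).2 Gs W Wvs.
  apply: noE; exists s => //; exists e => //; exists W.
  by split; rewrite // FX.
case: (EM (W v)) => Wv.
  apply/nestCrE/connected_nest; first exact: (bond_sideC bW).1.
  by move=> s /Ws; rewrite /setC /=; tauto.
apply/connected_nest; first exact: bW.1.
by move=> s /Ws; tauto.
Qed.

End FinitelyManyBonds.

(** * Rays, ends and the sides they live in *)

Section Points.
Variables (T : Type) (G : graph T).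
Implicit Types (X Y W Z : set T) (x y : T) (r : nat -> T) (p q : point T).

Definition tail_in r X := exists m, forall n, X (r (m + n)).

Lemma tail_in_sub r X Y : X `<=` Y -> tail_in r X -> tail_in r Y.
Proof. by move=> XY [m Xm]; exists m => n; apply: XY. Qed.

Lemma tail_inI r X Y : tail_in r X -> tail_in r Y -> tail_in r (X `&` Y).
Proof.
move=> [m Xm] [k Yk]; exists (m + k) => n.
by split; [rewrite -addnA|rewrite (addnC m) -addnA].
Qed.

Lemma tail_in_contra r X : tail_in r X -> tail_in r (~` X) -> False.
Proof. by move=> Xr nXr; have [m Xm] := tail_inI Xr nXr; case: (Xm 0). Qed.

Lemma ray_vertices r n : ray G r -> vertices G (r n).
Proof. by move=> [_ Gr]; have [] := edges_vertices (Gr n). Qed.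

Lemma ray_edges_inj r : injective r ->
  injective (fun n => [set r n; r n.+1]).
Proof.
move=> rI n k E; case: (set2_inj E) => [] [En Ek]; first exact: rI.
have nk := rI _ _ En; have /eqP := rI _ _ Ek.
by rewrite nk gtn_eqF// ltnS leqnSn.
Qed.

(** The edges of a ray are distinct, so only finitely many lie in the cut; after the last of them
    the ray stays on one side. *)
Lemma ray_side r X : ray G r -> finite_set (cut G X) ->
  tail_in r X \/ tail_in r (~` X).
Proof.
move=> [rI rG] fX; have [m nX] := finite_avoid fX (ray_edges_inj rI).
have key n : X (r (m + n)) <-> X (r m).
  elim: n => [|n IH]; first by rewrite addn0.
  rewrite addnS -IH; have := nX n; rewrite cut_edge//.
  by move: (EM (X (r (m + n)))) (EM (X (r (m + n).+1))); tauto.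
case: (EM (X (r m))) => Xm; [left|right]; exists m => n; first exact/key.
by move/key.
Qed.

Lemma ray_linked r X m : ray G r -> (forall n, X (r (m + n))) ->
  forall n, linked (induced G X) (r m) (r (m + n)).
Proof.
move=> [_ rG] Xr; elim=> [|n IH]; first by rewrite addn0; exact: linked_refl.
apply: linked_trans IH _; rewrite addnS; apply: linked_edge; split=> //.
by move=> _ [] ->; rewrite // -addnS.
Qed.

Lemma ray_comp_tail r X m : ray G r -> (forall n, X (r (m + n))) ->
  has_tail_in r (comp (induced G X) (r m)).
Proof.
move=> Gr Xr; have [rI rG] := Gr; exists m; split=> [a b /rI/addnI //|n].
rewrite addnS; split; last by move=> _ [] ->; rewrite -?addnS; exact: ray_linked.
by split=> // _ [] ->; rewrite // -addnS.
Qed.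

Lemma has_tail_in_vertices r (C : graph T) :
  has_tail_in r C -> tail_in r (vertices C).
Proof. by move=> [m [_ Cr]]; exists m => n; have [] := edges_vertices (Cr n). Qed.

(** The endvertices of the cut edges form a finite set S. Both rays have tails avoiding S, and no
    component of G - S meets both sides of X. *)
Lemma separates_tails r s X : ray G r -> ray G s -> finite_set (cut G X) ->
  tail_in r X -> tail_in s (~` X) -> ~ ray_equiv G r s.
Proof.
move=> Gr Gs fX Xr Xs; apply; pose S := ends_of_cut G X; exists S.
have fS : finite_set S by exact: finite_ends_of_cut.
have avoidS t : ray G t -> tail_in t (~` S).
  by move=> [tI _]; apply: finite_avoid.
have [m Xrm] := tail_inI Xr (avoidS r Gr).
have [k Xsk] := tail_inI Xs (avoidS s Gs).
have nSr n : (~` S) (r (m + n)) by have [] := Xrm n.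
have nSs n : (~` S) (s (k + n)) by have [] := Xsk n.
split=> //.
  move=> x [e [Ge [a [b [_ _ eab]]]]]; rewrite eab in Ge *.
  by have [Ga Gb] := edges_vertices Ge; case=> ->.
have Vr : vertices (del_vertices G S) (r m).
  by split; [exact: ray_vertices|have := nSr 0; rewrite addn0].
have Vs : vertices (del_vertices G S) (s k).
  by split; [exact: ray_vertices|have := nSs 0; rewrite addn0].
exists (comp (del_vertices G S) (r m)), (comp (del_vertices G S) (s k)).
split; [exact: comp_component|exact: comp_component| |exact: ray_comp_tail..].
move=> E.
have [_ rs] : vertices (comp (del_vertices G S) (r m)) (s k).
  by rewrite E; split=> //; exact: linked_refl.
have [+ _] := Xsk 0; rewrite addn0; apply.
apply: (linked_ind (P := X)) rs.
  by have [] := Xrm 0; rewrite addn0.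
move=> a b Xa [Gab abS]; apply: contrapT => Xb; apply: (abS a); first by left.
exists [set a; b]; last by left.
by apply/cut_edge.
Qed.

Lemma ray_equiv_refl r : ray_equiv G r r.
Proof.
move=> [S [_ _ [C [D [cC cD CD /has_tail_in_vertices Cr]]]]].
move=> /has_tail_in_vertices Dr; apply: CD.
have [m CDm] := tail_inI Cr Dr; have [Cm Dm] := CDm 0.
by rewrite (component_comp cC Cm) (component_comp cD Dm).
Qed.

Definition inside X p := match p with
  | inl x => X x
  | inr w => forall r, w r -> tail_in r X
  end.

(** Boolean, so that separation is inequality of booleans and arguments about corners become case
    distinctions. *)
Definition lives X p : bool := `[< inside X p >].

(** One ray decides for its whole end: a ray with a tail on the other side of a finite cut is not
    equivalent to it. *)
Lemma end_side w r X : ray G r ->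
  w = [set r' | ray G r' /\ ray_equiv G r r'] -> finite_set (cut G X) ->
  inside X (inr w) <-> tail_in r X.
Proof.
move=> Gr -> fX; split=> [|Xr s [Gs rs]].
  by apply; split=> //; exact: ray_equiv_refl.
case: (ray_side Gs fX) => // nXs.
by case: (separates_tails Gr Gs fX Xr nXs).
Qed.

Lemma livesC X p : Vhat G p -> finite_set (cut G X) ->
  lives (~` X) p = ~~ lives X p.
Proof.
move=> Gp fX; rewrite /lives -asbool_neg; apply: asbool_equiv_eq.
case: p Gp => [x _|w [r Gr wE]]; first by [].
rewrite (end_side Gr wE fX) (end_side Gr wE); last by rewrite cutC.
split=> [nXr Xr|nXr]; first exact: (tail_in_contra Xr nXr).
by case: (ray_side Gr fX).
Qed.

Lemma livesI X Y p : lives (X `&` Y) p = lives X p && lives Y p.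
Proof.
rewrite /lives -asbool_and; apply: asbool_equiv_eq; case: p => [//|w].
split=> [XY|[Xw Yw] r wr]; last by apply: tail_inI; [exact: Xw|exact: Yw].
by split=> r /XY; apply: tail_in_sub => x [].
Qed.

Lemma livesU X Y p : Vhat G p -> finite_set (cut G X) -> finite_set (cut G Y) ->
  lives (X `|` Y) p = lives X p || lives Y p.
Proof.
move=> Gp fX fY; rewrite -(setCK (X `|` Y)) setCU livesC//; last first.
  by apply: finite_cutI; rewrite cutC.
by rewrite livesI !livesC// negb_and !negbK.
Qed.

Lemma lives_sub X Y p : X `<=` Y -> lives X p -> lives Y p.
Proof.
move=> XY /asboolP Xp; apply/asboolP.
case: p Xp => [x /XY //|w Xw r /Xw]; exact: tail_in_sub.
Qed.

(** An edge leaving a component of G[X] must leave X. *)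
Lemma cut_linked_sub X x : X x ->
  cut G [set y | linked (induced G X) x y] `<=` cut G X.
Proof.
move=> Xx e [Ge [a [b [xa xb eab]]]]; split=> //; exists a, b.
have Xa : X a.
  by apply: (linked_ind (P := X)) xa => // c d _ [_]; apply; right.
split=> // Xb; apply: xb; apply: linked_trans xa _; apply: linked_edge.
by rewrite -eab; split=> //; rewrite eab => _ [] ->.
Qed.

Lemma lives_linked X p : Vhat G p -> finite_set (cut G X) -> lives X p ->
  exists x, [/\ vertices G x, X x &
                lives [set y | linked (induced G X) x y] p].
Proof.
case: p => [x Gx _|w [r Gr wE] fX] /asboolP.
  by exists x; split=> //; apply/asboolP; exact: linked_refl.
move=> /(end_side Gr wE fX)[m Xm]; exists (r m).
have Xrm : X (r m) by rewrite -(addn0 m).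
split=> //; first exact: ray_vertices.
apply/asboolP/(end_side Gr wE).
  exact/(sub_finite_set _ fX)/cut_linked_sub.
exists m => n; exact: ray_linked.
Qed.

End Points.

(** * Uncrossing minimum cuts *)

Lemma ex_argmin (A : Type) (P : A -> Prop) (f : A -> nat) : (exists x, P x) ->
  exists2 x, P x & forall y, P y -> f x <= f y.
Proof.
move=> [x0 Px0].
have ex : exists n, `[< exists2 x, P x & f x = n >].
  by exists (f x0); apply/asboolP; exists x0.
case: (ex_minnP ex) => n /asboolP[x Px <-] minx; exists x => // y Py.
by apply: minx; apply/asboolP; exists y.
Qed.

Section NestedBonds.
Variables (T : Type) (G : graph T) (Gconn : connected G).
Implicit Types (X Y W Z : set T) (p q r s : point T) (M : set (set T)).

Local Notation order X := (fcard (cut G X)).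
Local Notation cr n X := (fcard (crossing_bonds G X n)).

(** * Minimum cuts between two points *)

Definition sep X p q := lives X p != lives X q.

Definition sepmin p q X := [/\ Vhat G p, Vhat G q, finite_set (cut G X),
  sep X p q & forall Z, finite_set (cut G Z) -> sep Z p q -> order X <= order Z].

Lemma sepmin_ex p q Z : Vhat G p -> Vhat G q -> finite_set (cut G Z) ->
  sep Z p q -> exists X, sepmin p q X.
Proof.
move=> Gp Gq fZ sZ.
have [|X [fX sX] minX] := @ex_argmin _
  (fun X => finite_set (cut G X) /\ sep X p q) (fun X => order X).
  by exists Z.
by exists X; split=> // W fW sW; apply: minX.
Qed.

Lemma sepC X p q : Vhat G p -> Vhat G q -> finite_set (cut G X) ->
  sep (~` X) p q = sep X p q.
Proof. by move=> Gp Gq fX; rewrite /sep !(livesC _ fX)// (inj_eq negb_inj). Qed.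

Lemma sepminC p q X : sepmin p q X -> sepmin p q (~` X).
Proof. by case=> Gp Gq fX sX mX; split; rewrite ?sepC ?cutC. Qed.

Lemma sepmin_sym p q X : sepmin p q X -> sepmin q p X.
Proof.
case=> Gp Gq fX sX mX; split=> //; first by rewrite /sep eq_sym.
by move=> Z fZ sZ; apply: mX; rewrite // /sep eq_sym.
Qed.

Lemma sepmin_order p q r s X Z : sepmin p q X -> sepmin r s Z -> sep X r s ->
  sep Z p q -> order X = order Z.
Proof.
move=> [_ _ fX _ mX] [_ _ fZ _ mZ] sX sZ.
by apply/eqP; rewrite eqn_leq mX// mZ.
Qed.

Lemma sepmin_eq_order p q X Z : sepmin p q X -> finite_set (cut G Z) ->
  sep Z p q -> order Z = order X -> sepmin p q Z.
Proof. by case=> Gp Gq fX sX mX fZ sZ ZX; split=> // W; rewrite ZX; apply: mX. Qed.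

(* The part of G[X] containing p has its cut inside that of X, and still separates
   p from q. *)
Lemma sepmin_connected p q X : sepmin p q X -> lives X p ->
  connected (induced G X).
Proof.
move=> [Gp Gq fX sX mX] Xp.
have [x [Gx Xx]] := lives_linked Gp fX Xp.
set C := mkset _ => Cp; have CX := cut_linked_sub Xx (G := G).
have sC : sep C p q.
  move: sX; rewrite /sep Cp Xp; case Cq: (lives C q) => //.
  rewrite (lives_sub _ Cq)// => y.
  by apply: (linked_ind (P := X)) => // a b _ [_]; apply; right.
have fC : finite_set (cut G C) := sub_finite_set CX fX.
have Cx : C x by exact: linked_refl.
(* Minimality makes the two cuts equal, so the sides agree up to a swap, which x, lying in both,
   excludes. *)
case: (cut_inj Gconn (fcard_sub_eq fX CX (mX _ fC sC))) => E.
  by apply: (@connected_root _ _ x) => // y [Gy Xy]; apply/E.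
by case: ((E x Gx).1 Cx).
Qed.

Lemma sepmin_bond p q X : sepmin p q X -> bond_side G X.
Proof.
wlog Xp : X / lives X p => [H sX|sX].
  case Xp: (lives X p); first exact: H.
  rewrite -[X]setCK; apply/bond_sideC/H; last exact: sepminC.
  by have [Gp _ fX _ _] := sX; rewrite (livesC Gp fX) Xp.
split; first exact: sepmin_connected sX Xp.
apply: (sepmin_connected (sepmin_sym (sepminC sX))).
by have [_ Gq fX + _] := sX; rewrite (livesC Gq fX) /sep Xp.
Qed.

(** By submodularity the orders of the corners add up to at most those of X and Y, while minimality
    bounds each corner from below by the cut it replaces; so equality holds in both. *)
Lemma exchange p q r s X Y : sepmin p q X -> sepmin r s Y ->
  sep (X `&` Y) p q -> sep (X `|` Y) r s ->
  [/\ sepmin p q (X `&` Y), sepmin r s (X `|` Y),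
      order (X `&` Y) = order X & order (X `|` Y) = order Y].
Proof.
move=> sX sY sI sU; have [Gp Gq fX _ mX] := sX; have [Gr Gs fY _ mY] := sY.
have fI : finite_set (cut G (X `&` Y)) by exact: finite_cutI.
have fU : finite_set (cut G (X `|` Y)).
  by rewrite -cutC setCU; apply: finite_cutI; rewrite cutC.
have := cut_submod fX fY; have := mX _ fI sI; have := mY _ fU sU => leU leI sub.
have [EI EU] : order (X `&` Y) = order X /\ order (X `|` Y) = order Y.
  split; apply/eqP; rewrite eqn_leq ?leI ?leU ?andbT.
    by rewrite -(leq_add2r (order Y)) (leq_trans _ sub)// leq_add2l.
  by rewrite -(leq_add2l (order X)) (leq_trans _ sub)// leq_add2r.
split=> //; [exact: sepmin_eq_order sX _ _ _|exact: sepmin_eq_order sY _ _ _].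
Qed.

(** * Crossing numbers of opposite corners *)

Lemma crossing_bondsC X n : crossing_bonds G (~` X) n = crossing_bonds G X n.
Proof.
apply/seteqP; split=> F [W [bW FW fF nF XW]]; exists W; split=> // XW'.
  exact/XW/nestCl.
by apply: XW; rewrite -nestClE.
Qed.

(** If X lies in a side of W, so does the smaller intersection; if the complement of X does, so does
    the complement of the union. *)
Lemma nest_or X Y W : nest G X W -> nest G (X `&` Y) W \/ nest G (X `|` Y) W.
Proof.
case=> XW; [left; apply: Or41|left; apply: Or42|right; apply: Or43
  |right; apply: Or44] => x Gx H; apply: (XW x Gx).
- by case: H.
- by case: H.
- by move=> ?; apply: H; left.
- by move=> ?; apply: H; left.
Qed.

(** A bond crossing one of the corners crosses X or Y, and one crossing both corners crosses both.
    The inequality is strict because the cut of Y crosses X but neither corner. *)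
Lemma crossing_bonds_lt n X Y : finite_set (cut G X) -> finite_set (cut G Y) ->
  bond_side G Y -> order Y = n -> ~ nest G X Y ->
  cr n (X `&` Y) + cr n (X `|` Y) < cr n X + cr n Y.
Proof.
move=> fX fY bY nY XY.
apply: (@fcard_exchange_lt _ _ _ _ _ (cut G Y)).
- exact: finite_crossing_bonds.
- exact: finite_crossing_bonds.
- move=> F [] [W [bW FW fF nF IW]]; apply: contrapT => H.
    have [XW YW] : nest G X W /\ nest G Y W.
      by split; apply: contrapT => ?; apply: H; [left|right]; exists W.
    by apply/IW/nestS/nest_corner => //; exact: nestS.
  have [XW YW] : nest G X W /\ nest G Y W.
    by split; apply: contrapT => ?; apply: H; [left|right]; exists W.
  by apply/IW/nestS/nest_cornerU => //; exact: nestS.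
- move=> F [[W [bW FW fF nF IW]] [W' [_ FW' _ _ UW']]].
  (* The same bond F is given through two sides W and W'; crossing does not depend on the choice. *)
  have UW : ~ nest G (X `|` Y) W.
    by move=> UW; apply/UW'/(nest_cut Gconn _ UW); rewrite -FW.
  split; exists W; split=> //.
    by move=> /(nest_or Y)[].
  by move=> /(nest_or X); rewrite setIC setUC => -[].
- by exists Y.
- move=> [W [_ YW _ _]]; apply; apply: (nest_cut Gconn YW).
  exact: nestI_r.
- move=> [W [_ YW _ _]]; apply; apply: (nest_cut Gconn YW).
  by apply: Or44 => x _ XYx Yx; apply: XYx; right.
Qed.

(** * Optimal cuts of one size are nested *)

Definition nested_with M X := forall Y, M Y -> nest G X Y.

Lemma nested_withC M X : nested_with M X -> nested_with M (~` X).
Proof. by move=> MX Y /MX/nestCl. Qed.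

Lemma nested_with_corner M X Y : nested_with M X -> nested_with M Y ->
  ~ nest G X Y -> nested_with M (X `&` Y) /\ nested_with M (X `|` Y).
Proof.
move=> MX MY XY; split=> Z MZ; have ZX := nestS (MX Z MZ).
  exact/nestS/(nest_corner ZX (nestS (MY Z MZ)) XY).
exact/nestS/(nest_cornerU ZX (nestS (MY Z MZ)) XY).
Qed.

(** All competitors are minimum cuts for p, q and so have order n as well. *)
Definition optimal n M p q X := [/\ sepmin p q X, order X = n, nested_with M X &
  forall Z, sepmin p q Z -> nested_with M Z -> cr n X <= cr n Z].

Lemma optimalC n M p q X : optimal n M p q X -> optimal n M p q (~` X).
Proof.
move=> [sX nX MX mX]; split.
- exact: sepminC.
- by rewrite cutC.
- exact: nested_withC.
- by move=> Z sZ MZ; rewrite crossing_bondsC; exact: mX.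
Qed.

Lemma optimal_lives n M p q X : optimal n M p q X -> exists X',
  [/\ optimal n M p q X', lives X' p, ~~ lives X' q &
      X' = X \/ X' = ~` X].
Proof.
move=> oX; have [[Gp Gq fX sX _] _ _ _] := oX.
case Xp: (lives X p).
  by exists X; split=> //; [move: sX; rewrite /sep Xp|left].
exists (~` X); split; [exact: optimalC| | |by right].
  by rewrite (livesC Gp fX) Xp.
by rewrite (livesC Gq fX) negbK; move: sX; rewrite /sep Xp; case: lives.
Qed.

(* Both [X `&` Y] and [X `|` Y] are minimum cuts for p, q, and one of [X `&` Y],
   [X `|` Y] and [X] is one for r, s; in each case the choice of X and Y contradicts
   [crossing_bonds_lt]. *)
Lemma optimal_nest_opposite n M p q r s X Y :
  optimal n M p q X -> optimal n M r s Y ->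
  lives X p -> ~~ lives X q -> lives Y p -> ~~ lives Y q -> nest G X Y.
Proof.
move=> [sX nX MX mX] [sY nY MY mY] Xp Xq Yp Yq; apply: contrapT => XY.
have [Gp Gq fX _ _] := sX; have [Gr Gs fY sYrs _] := sY.
have sY' : sepmin p q Y.
  by apply: (sepmin_eq_order sX); rewrite ?nX// /sep Yp (negbTE Yq).
have sI : sep (X `&` Y) p q.
  by rewrite /sep !livesI Xp Yp (negbTE Xq).
have sU : sep (X `|` Y) p q.
  by rewrite /sep !(livesU _ fX fY)// Xp (negbTE Xq) (negbTE Yq).
have [mI mU nI nU] := exchange sX sY' sI sU.
have [MI MU] := nested_with_corner MX MY XY.
have lt := crossing_bonds_lt fX fY (sepmin_bond sY) nY XY.
have XI := mX _ mI MI; have XU := mX _ mU MU.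
have fI : finite_set (cut G (X `&` Y)) by case: mI.
have fU : finite_set (cut G (X `|` Y)) by case: mU.
(* If X does not separate r and s, both live in X and the intersection inherits the separation from
   Y, or neither does and the union inherits it. *)
have : [|| sep (X `&` Y) r s, sep (X `|` Y) r s | sep X r s].
  move: sYrs; rewrite /sep !livesI !(livesU _ fX fY)//.
  by case: (lives X r); case: (lives X s); case: (lives Y r); case: (lives Y s).
case/or3P => rs.
- have YI : cr n Y <= cr n (X `&` Y).
    by apply: mY => //; apply: (sepmin_eq_order sY) => //; rewrite nI nX.
  by move: lt; rewrite ltnNge addnC leq_add.
- have YU : cr n Y <= cr n (X `|` Y).
    by apply: mY => //; apply: (sepmin_eq_order sY) => //; rewrite nU nX.
  by move: lt; rewrite ltnNge leq_add.
(* Here X itself competes with Y, and [cr n X] is a lower bound for both corners. *)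
- have YX : cr n Y <= cr n X.
    by apply: mY => //; apply: (sepmin_eq_order sY) => //; rewrite nX.
  by move: lt; rewrite ltnNge leq_add// (leq_trans YX).
Qed.

(** Complementing X and Y where necessary puts p inside both and q outside both. *)
Lemma optimal_nest_sep n M p q r s X Y :
  optimal n M p q X -> optimal n M r s Y -> sep Y p q -> nest G X Y.
Proof.
move=> /optimal_lives[X' [oX Xp Xq EX]] oY sY.
have [[Gr Gs fY _ _] _ _ _] := oY; have [[Gp Gq _ _ _] _ _ _] := oX.
suff XY : nest G X' Y.
  by case: EX XY => -> // /nestClE.
case Yp: (lives Y p).
  by apply: (optimal_nest_opposite oX oY) => //; move: sY; rewrite /sep Yp.
apply/nestCrE/(optimal_nest_opposite oX (optimalC oY)) => //.
  by rewrite (livesC Gp fY) Yp.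
by rewrite (livesC Gq fY) negbK; move: sY; rewrite /sep Yp; case: lives.
Qed.

(** The intersection separates p, q as X does, and the union separates r, s as Y does; so each
    corner competes with the cut it replaces, against [crossing_bonds_lt]. *)
Lemma optimal_nest_same n M p q r s X Y :
  optimal n M p q X -> optimal n M r s Y ->
  ~~ lives X r -> ~~ lives X s -> lives Y p -> lives Y q -> nest G X Y.
Proof.
move=> [sX nX MX mX] [sY nY MY mY] Xr Xs Yp Yq; apply: contrapT => XY.
have [Gp Gq fX sXpq _] := sX; have [Gr Gs fY sYrs _] := sY.
have sI : sep (X `&` Y) p q by rewrite /sep !livesI Yp Yq !andbT.
have sU : sep (X `|` Y) r s.
  by rewrite /sep !(livesU _ fX fY)// (negbTE Xr) (negbTE Xs).
have [mI mU nI nU] := exchange sX sY sI sU.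
have [MI MU] := nested_with_corner MX MY XY.
have lt := crossing_bonds_lt fX fY (sepmin_bond sY) nY XY.
by move: lt; rewrite ltnNge leq_add// ?mX// mY.
Qed.

Lemma optimal_nest n M p q r s X Y :
  optimal n M p q X -> optimal n M r s Y -> nest G X Y.
Proof.
move=> oX oY.
case sY: (sep Y p q); first exact: optimal_nest_sep oX oY sY.
case sX: (sep X r s); first exact/nestS/(optimal_nest_sep oY oX sX).
have [[Gp Gq fX _ _] _ _ _] := oX; have [[Gr Gs fY _ _] _ _ _] := oY.
move/negbFE/eqP: sX => sX; move/negbFE/eqP: sY => sY.
(* Now neither cut separates the pair of the other; complements lead to the configuration of
   [optimal_nest_same]. *)
wlog Xr : X oX fX sX / ~~ lives X r => [H|].
  case Xr: (lives X r); last by apply: H => //; rewrite Xr.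
  apply/nestClE/H; rewrite ?cutC ?(livesC _ fX) ?sX//; first exact: optimalC.
  by rewrite -sX Xr.
wlog Yp : Y oY fY sY / lives Y p => [H|].
  case Yp: (lives Y p); first by apply: H => //; rewrite Yp.
  apply/nestCrE/H; rewrite ?cutC ?(livesC _ fY) ?sY//; first exact: optimalC.
  by rewrite -sY Yp.
by apply: (optimal_nest_same oX oY); rewrite -?sX -?sY.
Qed.

(** * Uncrossing from smaller cuts, and the recursive construction *)

(** Keeps what uncrossing uses of a corner, without saying which of the corners Z is. *)
Definition is_corner Z X Y := nest G Z Y /\
  forall W, nest G W X -> nest G W Y -> nest G W Z.

(** Being smaller than X, the cut of Y cannot separate p from q. Complements and a swap of r and s
    put p, q and r in Y, and s outside both X and Y; then [exchange] applies. *)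
Lemma corner_lower p q r s X Y : sepmin p q X -> sepmin r s Y ->
  order Y < order X -> ~ nest G X Y ->
  exists2 Z, sepmin p q Z & is_corner Z X Y.
Proof.
move=> sX sY YX; have [Gp Gq fX sXpq mX] := sX; have [Gr Gs fY sYrs mY] := sY.
have {YX} : lives Y p = lives Y q.
  by apply/eqP; apply: contraLR YX => /(mX _ fY); rewrite -leqNgt.
wlog Yp : Y sY fY sYrs mY / lives Y p => [H|].
  move=> Yq XY; case Yp: (lives Y p); first exact: (H Y).
  have [|||||||Z sZ [ZY ZXY]] := H (~` Y).
  - exact: sepminC.
  - by rewrite cutC.
  - by rewrite sepC.
  - by rewrite cutC.
  - by rewrite (livesC Gp fY) Yp.
  - by rewrite !(livesC _ fY)// Yq.
  - by rewrite nestCrE.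
  exists Z => //; split; first by rewrite -nestCrE.
  by move=> W WX WY; apply: ZXY => //; exact: nestCr.
wlog Ys : r s sY Gr Gs sYrs mY / ~~ lives Y s => [H|].
  case Ys: (lives Y s); last by apply: (H r s) => //; rewrite Ys.
  apply: (H s r) => //.
  - exact: sepmin_sym.
  - by rewrite /sep eq_sym.
  - by move=> Z fZ sZ; apply: mY; rewrite // /sep eq_sym.
  - by move: sYrs; rewrite /sep Ys; case: lives.
wlog Xs : X sX fX sXpq mX / ~~ lives X s => [H|].
  move=> Yq XY; case Xs: (lives X s); last by apply: (H X) => //; rewrite Xs.
  have [|||||||Z sZ [ZY ZXY]] := H (~` X) => //.
  - exact: sepminC.
  - by rewrite cutC.
  - by rewrite sepC.
  - by rewrite cutC.
  - by rewrite (livesC Gs fX) Xs.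
  - by rewrite nestClE.
  exists Z => //; split=> // W WX WY; apply: ZXY => //; exact: nestCr.
move=> Yq XY; exists (X `&` Y); last first.
  by split; [exact: nestI_r|move=> W WX WY; exact: nest_corner].
have [] // := @exchange p q r s X Y.
  by rewrite /sep !livesI -Yq Yp !andbT.
rewrite /sep !(livesU _ fX fY)// (negbTE Xs) (negbTE Ys).
by move: sYrs; rewrite /sep (negbTE Ys); case: (lives Y r); rewrite ?orbT.
Qed.

(* [level n] holds the sides of the chosen bonds of size less than n. *)
Fixpoint level n : set (set T) := if n is k.+1 then
    level k `|` [set X | exists p q, optimal k (level k) p q X]
  else set0.

Lemma level_sepmin n X : level n X ->
  exists p q, sepmin p q X /\ order X < n.
Proof.
elim: n => // n IH [/IH[p [q [sX lt]]]|[p [q [sX nX _ _]]]]; exists p, q.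
  by split=> //; exact: ltnW.
by rewrite nX.
Qed.

Lemma level_nested n X Y : level n X -> level n Y -> nest G X Y.
Proof.
elim: n => // n IH [nX|[p [q oX]]] [nY|[r [s oY]]].
- exact: IH.
- by apply: nestS; have [_ _ + _] := oY; apply.
- by have [_ _ + _] := oX; apply.
- exact: optimal_nest oX oY.
Qed.

Lemma level_sub m n : m <= n -> level m `<=` level n.
Proof.
move=> /subnK <-; elim: (n - m) => [//|k IH] X mX.
by rewrite addSn; left; exact: IH.
Qed.

(** Collects cuts instead of sides, since one cut has several sides: complements, and sets differing
    outside [vertices G]. *)
Definition crossed M X : set (set (set T)) :=
  [set F | exists2 Y, M Y /\ ~ nest G X Y & F = cut G Y].

Lemma finite_crossed n X : finite_set (cut G X) ->
  finite_set (crossed (level n) X).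
Proof.
move=> fX.
apply: (@sub_finite_set _ _ (\bigcup_(i in `I_n) crossing_bonds G X i)).
  move=> F [Y [nY XY] ->]; have [p [q [sY lt]]] := level_sepmin nY.
  exists (order Y) => //; exists Y; split=> //; first exact: sepmin_bond sY.
  by case: sY.
by apply: bigcup_finite => [|i _]; [exact: finite_II|exact: finite_crossing_bonds].
Qed.

(** Take a minimum cut Z crossed by the fewest chosen cuts. If some chosen Y crossed it, the corner
    from [corner_lower] would be crossed by fewer: no longer by Y, and by no new cut, since the
    chosen ones are nested with Y. *)
Lemma sepmin_nested_with n p q X : sepmin p q X -> order X = n ->
  exists2 Z, sepmin p q Z & nested_with (level n) Z.
Proof.
move=> sX nX.
have [|Z sZ mZ] := @ex_argmin _ (sepmin p q)
  (fun Z => fcard (crossed (level n) Z)).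
  by exists X.
exists Z => // Y nY; apply: contrapT => ZY.
have [r [s [sY lt]]] := level_sepmin nY.
have nZ : order Z = n.
  by rewrite -nX; apply: (sepmin_order sZ sX); [case: sZ|case: sX].
rewrite -nZ in lt; have [Z' sZ' [Z'Y cZ']] := corner_lower sZ sY lt ZY.
have := mZ _ sZ'; rewrite leqNgt => /negP; apply.
apply: (@fcard_proper _ _ _ (cut G Y)).
- by apply: finite_crossed; case: sZ.
- move=> F [W [nW Z'W] ->]; exists W => //; split=> // ZW; apply: Z'W.
  apply/nestS/cZ'; first exact: nestS.
  exact: level_nested nW nY.
- by exists Y.
- by move=> [W [_ Z'W] YW]; apply/Z'W/(nest_cut Gconn YW).
Qed.

Lemma optimal_ex p q X : sepmin p q X ->
  exists Z, optimal (order X) (level (order X)) p q Z.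
Proof.
move=> sX; pose n := order X.
have [|Z [sZ MZ] mZ] := @ex_argmin _
  (fun Z => sepmin p q Z /\ nested_with (level n) Z) (fun Z => cr n Z).
  by have [Z sZ MZ] := sepmin_nested_with sX erefl; exists Z.
exists Z; split=> //.
  by apply: (sepmin_order sZ sX); [case: sZ|case: sX].
by move=> W sW MW; apply: mZ.
Qed.

Lemma nested_bonds : exists N : set (set T),
  [/\ forall X, N X -> exists p q, sepmin p q X,
      forall X Y, N X -> N Y -> nest G X Y &
      forall p q X, sepmin p q X -> exists2 Z, N Z & sepmin p q Z].
Proof.
exists [set X | exists n, level n X]; split.
- by move=> X [n /level_sepmin[p [q [sX _]]]]; exists p, q.
- move=> X Y [n nX] [k kY]; apply: (@level_nested (maxn n k)).
    by apply: level_sub nX; exact: leq_maxl.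
  by apply: level_sub kY; exact: leq_maxr.
- move=> p q X sX; have [Z oZ] := optimal_ex sX.
  exists Z; last by case: oZ.
  (* Cuts of size n enter at level n + 1. *)
  by exists (order X).+1; right; exists p, q.
Qed.

End NestedBonds.

(** * Edge-blocks *)

Lemma fcard_card_le (U : choiceType) (A B : set U) :
  finite_set A -> finite_set B -> fcard A <= fcard B -> A #<= B.
Proof.
move=> fA fB leAB; have AI : A #= `I_(fcard A) by apply/fcardP.
have BI : B #= `I_(fcard B) by apply/fcardP.
by rewrite (card_le_eql AI) (card_le_eqr BI) card_le_II.
Qed.

Section EdgeBlocks.
Variables (T : Type) (G : graph T).
Implicit Types (X Y W Z : set T) (p q : point T) (P Q : set (point T)).
Implicit Types (F : set (set T)) (k : option nat).

Lemma fewer_than_finite F k : fewer_than F k -> finite_set F.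
Proof. by case: k => [n [m [_ Fm]]|//]; apply/finite_setP; exists m. Qed.

Lemma fewer_than_le F F' k : finite_set F' -> fcard F' <= fcard F ->
  fewer_than F k -> fewer_than F' k.
Proof.
move=> fF' le; case: k => [n [m [mn /fcardP[_ Fm]]]|//].
by exists (fcard F'); split; [rewrite (leq_ltn_trans le)// Fm|apply/fcardP].
Qed.

(** * Translation to bonds and sides within the vertex set *)

Lemma bond_side_bipartition X : bond_side G X ->
  bipartition G (vertices G `&` X) (vertices G `&` ~` X).
Proof.
move=> [[X0 _] [nX0 _]]; split=> //; first by rewrite -setIUr setUCr setIT.
by rewrite setIACA setICr setI0.
Qed.

Lemma cut_edges_between X :
  cut G X = edges_between G (vertices G `&` X) (vertices G `&` ~` X).
Proof.
apply/seteqP; split=> e [Ge [a [b [Xa Xb eab]]]]; split=> //; exists a, b.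
  rewrite eab in Ge; have [Ga Gb] := edges_vertices Ge.
  by split.
by case: Xa Xb => _ ? [].
Qed.

Lemma induced_vertices X : induced G (vertices G `&` X) = induced G X.
Proof.
apply: graph_eq; first by rewrite /= setIA setIid.
apply/seteqP; split=> e [Ge eX]; split=> // x ex; first by case: (eX x ex).
split; last exact: eX.
have [a [b [Ga Gb _ eab]]] := edges_pair Ge.
by move: ex; rewrite eab => -[] ->.
Qed.

Lemma bond_side_bond X : bond_side G X -> bond G (cut G X).
Proof.
move=> bX; have [cX cnX] := bX.
exists (vertices G `&` X), (vertices G `&` ~` X); rewrite !induced_vertices.
by split=> //; [exact: bond_side_bipartition|exact: cut_edges_between].
Qed.

Lemma bond_side_cut_side X : bond_side G X ->
  cut_side G (cut G X) (vertices G `&` X).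
Proof.
move=> bX; exists (vertices G `&` ~` X); last exact: cut_edges_between.
exact: bond_side_bipartition.
Qed.

(** Each empty corner is an inclusion between a side of one cut and a side of the other. *)
Lemma nest_nested X Y : bond_side G X -> bond_side G Y -> nest G X Y ->
  nested G (cut G X) (cut G Y).
Proof.
have sub X' Y' : bond_side G X' -> bond_side G Y' ->
    (forall x, vertices G x -> X' x -> Y' x) ->
    nested G (cut G X') (cut G Y').
  move=> bX bY XY; exists (vertices G `&` X'), (vertices G `&` Y').
  split; [exact: bond_side_cut_side..|].
  by move=> x [Gx X'x]; split=> //; exact: XY.
move=> bX bY; have bnX := bond_sideC bX; have bnY := bond_sideC bY.
case=> XY; rewrite -?(cutC G X) -?(cutC G Y).
- by rewrite !cutC; exact: sub.
- by rewrite cutC; exact: sub.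
- by rewrite (cutC G Y); exact: sub.
- exact: sub.
Qed.

(** X is the vertex set of the component C in which P lives: an edge leaving C must have been
    deleted, and q lives in a component disjoint from C. *)
Lemma separated_lives F P Q p q : live_in_distinct_components G F P Q ->
  P p -> Q q -> Vhat G q ->
  exists X, [/\ cut G X `<=` F, lives X p & ~~ lives X q].
Proof.
move=> [C [D [cC cD CD [CV CE] [DV DE]]]] Pp Qq Gq; exists (vertices C).
have disj x : vertices C x -> vertices D x -> False.
  move=> Cx Dx; apply: CD.
  by rewrite (component_comp cC Cx) (component_comp cD Dx).
split.
- move=> e [Ge [a [b [Ca Cb eab]]]]; apply: contrapT => Fe; apply: Cb.
  have ab : edges (del_edges G F) [set a; b] by rewrite -eab.
  rewrite (component_comp cC Ca); split; last exact: linked_edge.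
  by case: (edges_vertices ab).
- apply/asboolP; case: p Pp => [x /CV //|w Pw r wr].
  exact/has_tail_in_vertices/(CE w).
- apply/asboolPn; case: q Qq Gq => [y Qy _ Cy|w Qw [r Gr wE] Cw].
    exact: disj Cy (DV _ Qy).
  have wr : w r by rewrite wE; split=> //; exact: ray_equiv_refl.
  have Dr := has_tail_in_vertices (DE _ _ Qw wr).
  have [m CDm] := tail_inI (Cw r wr) Dr; have [Cm Dm] := CDm 0.
  exact: disj Cm Dm.
Qed.

(** Deleting the cut of X keeps G[X] intact and leaves no edge out of X, so the vertices in X form
    one component. *)
Lemma side_component X : connected (induced G X) -> exists C,
  [/\ component (del_edges G (cut G X)) C, vertices C !=set0,
      vertices C `<=` X &
      forall P, P `<=` Vhat G -> (forall p, P p -> lives X p) -> lives_in P C].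
Proof.
move=> [[x [Gx Xx]] Xl]; set H := del_edges _ _; exists (comp H x).
have XH a b : X a -> X b -> edges G [set a; b] -> edges H [set a; b].
  by move=> Xa Xb Gab; split=> // /(cut_edge X Gab); tauto.
have inC y : vertices G y -> X y -> linked H x y.
  move=> Gy Xy; apply: linked_sub (Xl x y _ _) => // e [Ge eX].
  have [a [b [_ _ _ eab]]] := edges_pair Ge; rewrite eab in Ge eX *.
  by apply: XH => //; apply: eX; [left|right].
split.
- exact: comp_component.
- by exists x; split=> //; exact: linked_refl.
- move=> y [_]; apply: (linked_ind (P := X)) => // a b Xa [Gab nab].
  by apply: contrapT => Xb; apply/nab/cut_edge.
- move=> P PG PX; split=> [y Py|w r Pw wr].
    have Gy := PG _ Py; have /asboolP Xy := PX _ Py.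
    by split=> //; exact: inC.
  have Gr : ray G r by have [r0 _ wE] := PG _ Pw; move: wr; rewrite wE => -[].
  have /asboolP/(_ r wr)[m Xm] := PX _ Pw; exists m.
  have [rI rG] := Gr; split=> [a b /rI/addnI //|n].
  split; first by rewrite addnS; apply: XH; rewrite // -addnS.
  by move=> _ [] ->; apply: inC => //; exact: ray_vertices.
Qed.

Lemma bond_side_separates X P Q : bond_side G X -> finite_set (cut G X) ->
  P `<=` Vhat G -> Q `<=` Vhat G -> (forall p, P p -> lives X p) ->
  (forall q, Q q -> ~~ lives X q) ->
  live_in_distinct_components G (cut G X) P Q.
Proof.
move=> [cX cnX] fX PG QG PX QX.
have [C [cC [x Cx] CX CP]] := side_component cX.
have [D [cD _ DX DQ]] := side_component cnX.
rewrite cutC in cD; exists C, D; split=> //.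
- by move=> CD; apply: (DX x); [rewrite -CD|exact: CX].
- exact: CP.
- by apply: DQ => // q Qq; rewrite (livesC _ fX) ?QX//; exact: QG.
Qed.

Lemma inseparable_refl k p : Vhat G p -> inseparable G k p p.
Proof.
move=> Gp [F [_ _ sF]]; have [] // := separated_lives sF (p := p) (q := p).
by move=> X [_ ->].
Qed.

Lemma not_inseparable k p q : Vhat G q -> ~ inseparable G k p q ->
  exists X, [/\ finite_set (cut G X), fewer_than (cut G X) k & sep X p q].
Proof.
move=> Gq /contrapT[F [_ Fk sF]]; have fF := fewer_than_finite Fk.
have [X [XF Xp Xq]] := separated_lives sF (erefl p) (erefl q) Gq.
have fX := sub_finite_set XF fF; exists X; split=> //.
  by apply: fewer_than_le Fk => //; exact: fcard_sub.
by rewrite /sep Xp (negbTE Xq).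
Qed.

Lemma inseparable_lives k p q X : Vhat G p -> Vhat G q ->
  bond_side G X -> finite_set (cut G X) -> fewer_than (cut G X) k ->
  inseparable G k p q -> lives X p -> lives X q.
Proof.
move=> Gp Gq bX fX Xk pq Xp; apply: contrapT => /negP Xq; apply: pq.
exists (cut G X); split=> //; first by move=> e [].
by apply: bond_side_separates => // _ ->.
Qed.

(** A minimum cut between the representatives is at most as large as the cuts witnessing their
    separability for k1 and k2, so it splits neither block. *)
Lemma sepmin_distinguishes k1 k2 p1 p2 X : connected G -> sepmin G p1 p2 X ->
  ~ inseparable G k1 p1 p2 -> ~ inseparable G k2 p2 p1 ->
  distinguishes_efficiently G (cut G X)
    [set q | Vhat G q /\ inseparable G k1 p1 q]
    [set q | Vhat G q /\ inseparable G k2 p2 q].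
Proof.
move=> Gc; wlog Xp1 : X / lives X p1 => [H sX n1 n2|].
  case Xp1: (lives X p1); first exact: H.
  rewrite -cutC; apply: H => //; last exact: sepminC.
  by have [G1 _ fX _ _] := sX; rewrite (livesC G1 fX) Xp1.
move=> sX n1 n2; have bX := sepmin_bond Gc sX; have [G1 G2 fX s12 mX] := sX.
have Xp2 : ~~ lives X p2 by move: s12; rewrite /sep Xp1.
have [Y1 [fY1 Y1k s1]] := not_inseparable G2 n1.
have [Y2 [fY2 Y2k]] := not_inseparable G1 n2; rewrite /sep eq_sym => s2.
have Xk1 := fewer_than_le fX (mX _ fY1 s1) Y1k.
have Xk2 := fewer_than_le fX (mX _ fY2 s2) Y2k.
split; first split; first by move=> e [].
  apply: bond_side_separates => //.
  - by move=> q [].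
  - by move=> q [].
  - by move=> q [Gq pq]; apply: inseparable_lives pq Xp1.
  - move=> q [Gq pq]; rewrite -(livesC Gq fX).
    apply: inseparable_lives pq _ => //; rewrite ?cutC//; first exact: bond_sideC.
    by rewrite (livesC G2 fX).
(* Any F' distinguishing the blocks contains a cut separating p1 from p2, hence has at least
   [fcard (cut G X)] edges. *)
move=> [F' [[leF' nle] [_ dF']]]; apply: nle.
have fF' := card_le_finite leF' fX.
have refl k p : Vhat G p -> Vhat G p /\ inseparable G k p p.
  by move=> Gp; split=> //; exact: inseparable_refl.
have [Z [ZF' Zp1 Zp2]] := separated_lives dF' (refl _ _ G1) (refl _ _ G2) G2.
apply: fcard_card_le => //; apply: leq_trans (fcard_sub fF' ZF').
apply: mX; first exact: sub_finite_set fF'.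
by rewrite /sep Zp1 (negbTE Zp2).
Qed.

End EdgeBlocks.

Theorem theorem1 (T : Type) (G : graph T) (Gconn : connected G) :
  exists N : set (set (set T)),
    [/\ forall F, N F -> bond G F,
        forall F1 F2, N F1 -> N F2 -> nested G F1 F2 &
        forall b1 b2 : set (point T),
          edge_block G b1 -> edge_block G b2 -> b1 `&` b2 = set0 ->
          exists F, N F /\ distinguishes_efficiently G F b1 b2].
Proof.
have [N [Nmin Nnest Nsep]] := nested_bonds Gconn.
have Nbond X : N X -> bond_side G X.
  by move=> /Nmin[p [q]]; exact: sepmin_bond.
exists (cut G @` N); split.
- by move=> _ [X NX <-]; exact/bond_side_bond/Nbond.
- move=> _ _ [X NX <-] [Y NY <-].
  exact: nest_nested (Nbond _ NX) (Nbond _ NY) (Nnest _ _ NX NY).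
- move=> _ _ [k1 [p1 G1 ->]] [k2 [p2 G2 ->]] disj.
  have n1 : ~ inseparable G k1 p1 p2.
    move=> p12; have : set0 p2; last by [].
    by rewrite -disj; split; split=> //; exact: inseparable_refl.
  have n2 : ~ inseparable G k2 p2 p1.
    move=> p21; have : set0 p1; last by [].
    by rewrite -disj; split; split=> //; exact: inseparable_refl.
  (* Even when k1 is infinite the separating cut is finite, so a minimum one exists. *)
  have [Y [fY _ sY]] := not_inseparable G2 n1.
  have [X0 sX0] := sepmin_ex G1 G2 fY sY.
  have [X NX sX] := Nsep _ _ _ sX0.
  by exists (cut G X); split; [exists X|exact: sepmin_distinguishes].
Qed.
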